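(* Let $G$ be a finite simple graph on $n$ vertices with minimum degree $\delta$. Then $\gamma_{gr}^L(G) \leq n - \delta + 1$.
   Context: All graphs are finite, simple and undirected. For a vertex $v$, $N(v)$ is its open neighborhood (the set of its neighbors) and $N[v] = N(v) \cup \{v\}$ its closed neighborhood. An L-sequence of $G$ is a sequence $(v_1, \ldots, v_k)$ of distinct vertices of $G$ such that for every $i \in \{1,\ldots,k\}$, $N[v_i] \setminus \bigcup_{j=1}^{i-1} N(v_j) \neq \emptyset$. The L-Grundy domination number $\gamma_{gr}^L(G)$ is the maximum length of an L-sequence of $G$. *)

(* Defs.v *)
From mathcomp Require Import all_boot.

Set Implicit Arguments.
Unset Strict Implicit.
Unset Printing Implicit Defensive.

(* A simple graph is a symmetric irreflexive relation e on a finType T; these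
   two properties are hypotheses of the theorem, not part of the definitions. *)
Section LGrundy.
Variables (T : finType) (e : rel T).

Definition open_nbh (v : T) : {set T} := [set u | e v u].

Definition closed_nbh (v : T) : {set T} := v |: open_nbh v.

Definition degree (v : T) : nat := #|open_nbh v|.

(* Degrees are at most #|T|, so the default value #|T| does not affect the
   minimum when T is nonempty; for the graph with no vertices it gives 0. *)
Definition min_degree : nat := \big[minn/#|T|]_(v : T) degree v.

Definition L_sequence (k : nat) (s : k.-tuple T) : bool :=
  uniq s &&
  [forall i : 'I_k,
     closed_nbh (tnth s i) :\: \bigcup_(j < k | j < i) open_nbh (tnth s j)
       != set0].

(* An L-sequence has distinct entries, so its length is at most #|T| and the
   range k <= #|T| loses nothing. *)
Definition L_grundy : nat :=
  \max_(k < #|T|.+1 | [exists s : k.-tuple T, L_sequence s]) k.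

Lemma min_degree_le (v : T) : min_degree <= degree v.
Proof.
rewrite /min_degree; elim: index_enum (mem_index_enum v) => // u r IHr.
rewrite inE big_cons => /orP[/eqP <-|/IHr]; first exact: geq_minl.
exact/leq_trans/geq_minr.
Qed.

Lemma min_degree_attained : 0 < #|T| -> exists v, min_degree = degree v.
Proof.
case/card_gt0P=> v0 _; rewrite /min_degree.
have [w _ wmin] : exists2 w, true & forall v, degree w <= degree v.
  by exists [arg min_(v < v0) degree v] => // v; case: arg_minnP => // w _; apply.
exists w; apply/eqP; rewrite eqn_leq; apply/andP; split.
  exact: min_degree_le.
elim/big_ind: _ => [|x y hx hy|v _]; first exact: max_card.
  by rewrite leq_min hx.
exact: wmin.
Qed.

Lemma L_sequence_le (k : nat) (s : k.-tuple T) : L_sequence s -> k <= L_grundy.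
Proof.
move=> Ls; have kT : k < #|T|.+1.
  by case/andP: Ls => us _; rewrite ltnS -(size_tuple s) -(card_uniqP us) max_card.
rewrite /L_grundy (bigD1 (Ordinal kT)) /= ?leq_maxl //.
by apply/existsP; exists s.
Qed.

Lemma L_grundy_attained : exists s : L_grundy.-tuple T, L_sequence s.
Proof.
apply/existsP; rewrite /L_grundy.
apply: (big_ind (fun k => [exists s : k.-tuple T, L_sequence s])) => //.
- by apply/existsP; exists [tuple]; apply/andP; split=> //; apply/forallP; case.
- by move=> x y hx hy; case: (leqP x y).
Qed.

End LGrundy.

(* Main.v *)
(** Some [u] in the closed neighborhood of the last vertex of an L-sequence of
    length [k] is adjacent to none of the [k - 1] earlier vertices.  These are
    distinct and lie outside [N(u)], so [k - 1 <= n - deg u <= n - delta]. *)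
Require Import Defs.
From mathcomp Require Import all_boot.

Lemma L_sequence_size_leq (T : finType) (e : rel T) (k : nat)
    (s : k.+1.-tuple T) :
  symmetric e -> L_sequence e s -> k <= #|T| - min_degree e.
Proof.
move=> e_sym /andP[/tuple_uniqP s_inj /forallP/(_ ord_max)].
case/set0Pn=> u /setDP[_ uNprev].
(* [lift ord_max] runs over the indices before the last one. By symmetry, an earlier vertex in
   [N(u)] would have [u] in its own open neighborhood, against [uNprev]. *)
have prev_sub : [set tnth s (lift ord_max i) | i : 'I_k] \subset ~: open_nbh e u.
  apply/subsetP=> _ /imsetP[i _ ->]; rewrite !inE e_sym.
  apply: contra uNprev => eiu; apply/bigcupP; exists (lift ord_max i).
    by rewrite lift_max /=.
  by rewrite inE.
have card_prev : #|[set tnth s (lift ord_max i) | i : 'I_k]| = k.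
  by rewrite card_imset ?card_ord // => i j /s_inj /lift_inj.
rewrite -card_prev; apply: leq_trans (subset_leq_card prev_sub) _.
(* The complement of [N(u)] has [#|T|] minus the degree of [u] elements. *)
by rewrite cardsCs setCK leq_sub2l // min_degree_le.
Qed.

Theorem theorem2p1 (T : finType) (e : rel T)
    (e_sym : symmetric e) (e_irr : irreflexive e) :
  L_grundy e <= #|T| - min_degree e + 1.
Proof.
have [s Ls] := L_grundy_attained e.
(* A maximum of 0 satisfies the bound trivially; otherwise a longest sequence has a last vertex. *)
case: (L_grundy e) s Ls => // k s Ls.
by rewrite addn1 ltnS; apply: L_sequence_size_leq Ls.
Qed.
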